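(* A graph $G$ is the corona of a bipartite multigraph $H$ if and only if $G$ is a self-dual bipartite multigraph with a unique perfect matching and with bipartite associated digraph $D$.
   Context: Graphs are finite, may have multiple edges between distinct vertices, and have no loops. The corona of a graph $H$ is the graph obtained from $H$ by adding, for each vertex of $H$, a new neighbor of degree $1$ adjacent to it. A perfect matching is a set of edges covering each vertex exactly once. Let $G$ be bipartite on $2n$ vertices with a unique perfect matching. Its vertices are labelled $1,\dots,2n$ so that the matching consists of the edges $\{i,n+i\}$, $1\le i\le n$, the sets $\{1,\dots,n\}$ and $\{n+1,\dots,2n\}$ are the two colour classes, and every non-matching edge joins some $i$ to some $n+j$ with $1\le i<j\le n$ (such a labelling always exists). The associated digraph $D$ has vertex set $\{1,\dots,n\}$ and one edge $i\to j$ for each edge of $G$ joining $i$ and $n+j$ ($i\ne j$); $D$ is bipartite if its underlying undirected graph is. $B$ is the $n\times n$ upper unitriangular matrix with $B_{i,i}=1$ and $B_{i,j}$ the number of edges $i\to j$ of $D$ for $i\ne j$. $G^+$ is the graph with adjacency matrix $\begin{pmatrix}0&|(B^T)^{-1}|\\|B^{-1}|&0\end{pmatrix}$, where $|\cdot|$ is the componentwise absolute value. $G$ is self-dual if $G=G^+$, where equality means that $G$ and $G^+$ are isomorphic graphs. *)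

(* Defs.v *)
From HB Require Import structures.
From mathcomp Require Import all_boot all_order all_algebra.

Set Implicit Arguments.
Unset Strict Implicit.
Unset Printing Implicit Defensive.

Import Order.TTheory GRing.Theory Num.Theory.

(* Edges form a type of their own, so that parallel edges are distinct; in
   particular a perfect matching is a set of edges, and an edge of a unique
   perfect matching has no parallel edge. *)
Record mgraph := MGraph {
  vertex : finType;
  edge : finType;
  ends : edge -> {set vertex};
  card_ends : forall e, #|ends e| = 2
}.

Definition mult (G : mgraph) (u v : vertex G) : nat :=
  #|[set e : edge G | ends e == [set u; v]]|.

Definition isomorphic (G H : mgraph) : Prop :=
  exists (f : vertex G -> vertex H) (g : edge G -> edge H),
    [/\ bijective f, bijective g & forall e, ends (g e) = f @: ends e].

Definition bipartite (G : mgraph) : Prop :=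
  exists c : vertex G -> bool,
    forall (e : edge G) (u v : vertex G), ends e = [set u; v] -> c u != c v.

Definition perfect_matching (G : mgraph) (M : {set edge G}) : Prop :=
  forall v : vertex G, #|[set e in M | v \in ends e]| = 1.

Section Corona.
Variable H : mgraph.

(* [inl v] is the vertex [v] of [H], [inr v] the pendant vertex attached to
   it; [inr v] as an edge is the one joining these two. *)
Definition corona_ends (e : edge H + vertex H) : {set vertex H + vertex H} :=
  match e with
  | inl e => inl @: ends e
  | inr v => [set inl v; inr v]
  end.

Lemma card_corona_ends e : #|corona_ends e| = 2.
Proof.
case: e => [e|v] /=; last by rewrite cards2.
by rewrite card_imset ?card_ends // => x y [].
Qed.

Definition corona : mgraph := MGraph card_corona_ends.
End Corona.

(* Only the entries above the diagonal are read: the intended argument is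
   symmetric with zero diagonal (see [mult_graph_of_mx]). *)
Section GraphOfMatrix.
Variables (m : nat) (A : 'M[nat]_m).

Definition mx_edge : Type :=
  {e : {ij : 'I_m * 'I_m & 'I_(A ij.1 ij.2)} | (tag e).1 < (tag e).2}.
HB.instance Definition _ := SubFinite.on mx_edge.

Definition mx_ends (e : mx_edge) : {set 'I_m} :=
  [set (tag (val e)).1; (tag (val e)).2].

Lemma card_mx_ends e : #|mx_ends e| = 2.
Proof. by rewrite cards2 neq_ltn (valP e). Qed.

Definition graph_of_mx : mgraph := MGraph card_mx_ends.

Lemma mult_graph_of_mx (symA : forall i j, A i j = A j i)
    (diagA : forall i, A i i = 0) (i j : vertex graph_of_mx) :
  mult i j = A i j.
Proof.
wlog ltij: i j / i < j => [Hw|].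
  case: (ltngtP i j) => [/Hw //|ltji|/val_inj <-].
    by rewrite symA -(Hw j i ltji); apply: eq_card => e; rewrite !inE setUC.
  rewrite diagA; apply/eqP; rewrite cards_eq0; apply/eqP/setP => e.
  rewrite !inE; apply/negP => /eqP /(congr1 (fun B : {set _} => #|B|)).
  by rewrite card_ends setUid cards1.
pose h (k : 'I_(A i j)) : edge graph_of_mx :=
  exist (fun e : {ij : 'I_m * 'I_m & 'I_(A ij.1 ij.2)} =>
           (tag e).1 < (tag e).2)
    (existT (fun ij : 'I_m * 'I_m => 'I_(A ij.1 ij.2)) (i, j) k) ltij.
have h_inj : injective h.
  move=> k k' /(congr1 val) /= /eqP.
  by rewrite -tag_eqE /tag_eq /= eqxx /= tagged_asE => /eqP.
rewrite -[RHS]card_ord -cardsT -(card_imset _ h_inj); apply: eq_card => e.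
rewrite inE; apply/eqP/imsetP => [|[k _ ->] //].
case: e => [[[a b] k] /= ltab]; rewrite /mx_ends /= => eq_ab.
have /set2P[ai|aj] : a \in [set i; j] by rewrite -eq_ab set21.
  have /set2P[bi|bj] : b \in [set i; j] by rewrite -eq_ab set22.
    by exfalso; have := ltab; rewrite ai bi ltnn.
  move: k ltab; rewrite ai bj => k ltab.
  by exists k => //; apply: val_inj.
have /set2P[bi|bj] : b \in [set i; j] by rewrite -eq_ab set22.
  by exfalso; have := ltab; rewrite aj bi ltnNge (ltnW ltij).
by exfalso; have := ltab; rewrite aj bj ltnn.
Qed.
End GraphOfMatrix.

Record mdigraph := MDigraph {
  dvertex : finType;
  darc : finType;
  src : darc -> dvertex;
  tgt : darc -> dvertex;
  src_neq_tgt : forall a, src a != tgt a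
}.

Lemma card_arc_ends (D : mdigraph) (a : darc D) : #|[set src a; tgt a]| = 2.
Proof. by rewrite cards2 src_neq_tgt. Qed.

Definition underlying (D : mdigraph) : mgraph := MGraph (@card_arc_ends D).

(* With 'I_(n + n) in the role of {1, ..., 2n}, [lshift n i] stands for the
   label i and [rshift n j] for the label n + j. *)
Record labelling (G : mgraph) (M : {set edge G}) (n : nat) := Labelling {
  lab :> 'I_(n + n) -> vertex G;
  lab_bij : bijective lab;
  lab_matching : [set ends e | e in M] =
    [set [set lab (lshift n i); lab (rshift n i)] | i : 'I_n];
  lab_colour : forall e : edge G, exists i j : 'I_n,
    ends e = [set lab (lshift n i); lab (rshift n j)];
  lab_upper : forall e : edge G, e \notin M -> exists i j : 'I_n,
    i < j /\ ends e = [set lab (lshift n i); lab (rshift n j)]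
}.

Section Associated.
Variables (G : mgraph) (M : {set edge G}) (n : nat) (L : labelling M n).

Definition assoc_arc : Type :=
  {a : 'I_n * 'I_n * edge G | (a.1.1 != a.1.2) &&
     (ends a.2 == [set L (lshift n a.1.1); L (rshift n a.1.2)])}.
HB.instance Definition _ := SubFinite.on assoc_arc.

Lemma assoc_arc_neq (a : assoc_arc) : (val a).1.1 != (val a).1.2.
Proof. by case/andP: (valP a). Qed.

Definition assoc_digraph : mdigraph := MDigraph assoc_arc_neq.

Definition assoc_mx : 'M[int]_n :=
  \matrix_(i, j) Posz (if i == j then 1 else
    #|[set a : darc assoc_digraph | (src a == i) && (tgt a == j)]|).

Definition dual_mx : 'M[nat]_(n + n) :=
  block_mx (const_mx 0) (map_mx absz (invmx (assoc_mx^T)%R))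
           (map_mx absz (invmx assoc_mx)) (const_mx 0).

Definition dual_graph : mgraph := graph_of_mx dual_mx.

Lemma mult_dual_graph (i j : vertex dual_graph) : mult i j = dual_mx i j.
Proof.
apply: mult_graph_of_mx => {i j} [i j|i]; last first.
  by case: (split_ordP i) => k ->; rewrite ?block_mxEul ?block_mxEdr mxE.
case: (split_ordP i) => k ->; case: (split_ordP j) => l ->;
  rewrite ?block_mxEul ?block_mxEdr ?block_mxEur ?block_mxEdl;
  by rewrite -?trmx_inv !mxE.
Qed.

(* Another labelling of [G] gives an isomorphic [dual_graph], and the same
   [underlying assoc_digraph] up to isomorphism (contract the matching). *)
Definition self_dual : Prop := isomorphic G dual_graph.
End Associated.

(* Main.v *)
Require Import Defs.
From mathcomp Require Import all_boot all_order all_algebra.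

Set Implicit Arguments.
Unset Strict Implicit.
Unset Printing Implicit Defensive.

Import Order.TTheory GRing.Theory Num.Theory.

(** Everything turns on one property of the associated digraph D: it has no two
    consecutive arcs, so that every vertex of D is a source or a sink. With N
    the matrix of arc multiplicities, so that B = 1 + N, this says N^2 = 0
    ([arc_mx_square0P]).

    If N^2 = 0, then B^-1 = 1 - N and |B^-1| = B, so exchanging the two colour
    classes of G is an isomorphism from G to its dual
    ([self_dual_of_no_consecutive]). Moreover, of the two ends of the i-th
    matching edge, at most one has further edges; the other ends are pendant,
    and G is the corona of the underlying graph of D
    ([corona_of_no_consecutive]).

    Conversely, assume that D is bipartite with G self-dual. Up to sign, the
    (i, j) entry of N^k counts the directed walks of length k from i to j; as D
    is bipartite, all walks from i to j have the same parity, so no cancellation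
    takes place in B^-1 = 1 - N + N^2 - ..., and |B^-1| = 1 + N + N^2 + ....
    The sum of the entries of |B^-1| is the number of edges of the dual, that of
    B = 1 + N is the number of edges of G. Self-duality makes them equal, so
    that N^2 = 0 ([square0_of_abs_sum], [no_consecutive_of_self_dual]).

    Finally, in the corona of a graph H with colouring c, the pendant edges
    form the only perfect matching. Enumerate H with one colour class
    before the other, and let the first half of the labels take the vertices of
    H in the first class and the pendant neighbours of those in the second:
    then all arcs of D go from the first class to the second, and no two of
    them are consecutive ([corona_labelling]). *)

(** * Maps between finite types, and isomorphisms of multigraphs *)

Lemma surj_inj_bij (T U : finType) (f : T -> U) :
  injective f -> (forall y, exists x, f x = y) -> bijective f.
Proof.
move=> f_inj f_surj; apply: (inj_card_bij f_inj).
rewrite -(card_imset predT f_inj) subset_leq_card //.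
by apply/subsetP => y _; have [x <-] := f_surj y; rewrite imset_f.
Qed.

(** Edges are unordered pairs; a predicate that separates their two ends, here
    the side of the bipartition, recovers the order. *)
Lemma set2_cross (T : finType) (P : pred T) (a b c d : T) :
  P a -> ~~ P b -> P c -> ~~ P d ->
  [set a; b] = [set c; d] -> a = c /\ b = d.
Proof.
move=> Pa Pb Pc Pd E.
have: a \in [set c; d] by rewrite -E set21.
have: b \in [set c; d] by rewrite -E set22.
case/set2P=> Eb /set2P[] Ea; subst=> //.
- by rewrite Pc in Pb.
- by rewrite Pc in Pb.
- by rewrite Pa in Pd.
Qed.

Lemma sum_card_fibres (T I : finType) (h : T -> I) :
  \sum_i #|[set t | h t == i]| = #|T|.
Proof.
rewrite -sum1_card (partition_big h xpredT) //=; apply: eq_bigr => i _.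
by rewrite sum1dep_card.
Qed.

Lemma mult_sym (G : mgraph) (u v : vertex G) : mult u v = mult v u.
Proof. by rewrite /mult setUC. Qed.

Lemma isomorphic_sym (G H : mgraph) : isomorphic G H -> isomorphic H G.
Proof.
case=> f [g] [[f' fK f'K] [g' gK g'K] fg]; exists f', g'.
split; [by exists f | by exists g | move=> e].
rewrite -{2}(g'K e) fg -imset_comp.
by rewrite (eq_imset _ (_ : f' \o f =1 id)) ?imset_id.
Qed.

(** Parallel edges are interchangeable, so those joining [u] and [v] can be sent
    to those joining [f u] and [f v] in the order of enumeration. *)
Lemma edge_embedding (G H : mgraph) (f : vertex G -> vertex H) :
  injective f -> (forall u v, mult u v <= mult (f u) (f v)) ->
  exists2 g : edge G -> edge H,
    injective g & forall e, ends (g e) = f @: ends e.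
Proof.
move=> f_inj le_mult.
pose par (K : mgraph) (A : {set vertex K}) := [set e : edge K | ends e == A].
have le_par e : #|par G (ends e)| <= #|par H (f @: ends e)|.
  have /eqP/cards2P[u [v [_ Ee]]] := card_ends e.
  by rewrite Ee imsetU !imset_set1; exact: (le_mult u v).
have par_e e : e \in par G (ends e) by rewrite inE.
pose rk e : 'I_#|par H (f @: ends e)| :=
  widen_ord (le_par e) (enum_rank_in (par_e e) e).
have ends_g e : ends (enum_val (rk e)) = f @: ends e.
  by have := enum_valP (rk e); rewrite inE => /eqP.
exists (fun e => enum_val (rk e)) => // e1 e2 E.
have eqe: ends e1 = ends e2.
  by apply: (imset_inj f_inj); rewrite -!ends_g E.
(* The type of the ranks depends on the ends, hence the generalization. *)
rewrite /rk in E.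
move: (le_par e1) (le_par e2) (par_e e1) (par_e e2) E; rewrite -eqe.
move=> l1 l2 q1 q2 /enum_val_inj/(congr1 val)/=/val_inj/(congr1 enum_val).
by rewrite !enum_rankK_in // inE eqe.
Qed.

(** Only multiplicities have to be compared to recognize isomorphic graphs. *)
Lemma isomorphic_of_mult (G H : mgraph) (f : vertex G -> vertex H) :
  bijective f -> (forall u v, mult u v = mult (f u) (f v)) -> isomorphic G H.
Proof.
move=> f_bij eq_mult; have [f' fK f'K] := f_bij.
have [||g g_inj gE] := @edge_embedding G H f.
- exact: can_inj fK.
- by move=> u v; rewrite eq_mult.
have [||g' g'_inj _] := @edge_embedding H G f'.
- exact: can_inj f'K.
- by move=> u v; rewrite eq_mult !f'K.
exists f, g; split=> //; apply: inj_card_bij => //.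
exact: leq_card g'_inj.
Qed.

Lemma bipartite_of_colour (G : mgraph) (c : vertex G -> bool) :
  (forall e : edge G, exists u v, [/\ ends e = [set u; v], c u & ~~ c v]) ->
  bipartite G.
Proof.
move=> cP; exists c => e u v Euv; have [x [y [Exy cx cy]]] := cP e.
have uv : u != v by have := card_ends e; rewrite Euv cards2; case: eqP.
move: (set21 u v) (set22 u v); rewrite -Euv Exy.
by case/set2P=> Eu /set2P[] Ev; move: uv;
  rewrite Eu Ev ?eqxx // cx (negPf cy).
Qed.

(** * The inverse of a unitriangular matrix and its absolute value *)

Section Unitriangular.
Local Open Scope ring_scope.
Variables (n : nat) (N : 'M[int]_n).
Hypothesis N_upper : forall i j : 'I_n, ~~ (i < j)%N -> N i j = 0.

Lemma unitmx_upper : 1%:M + N \in unitmx.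
Proof.
rewrite unitmxE -det_tr det_trig; last first.
  apply/is_trig_mxP => i j lt_ij; rewrite !mxE N_upper ?addr0; last first.
    by rewrite -leqNgt ltnW.
  by rewrite -val_eqE /= gtn_eqF.
by rewrite big1 ?unitr1 // => i _; rewrite !mxE eqxx N_upper ?addr0 // ltnn.
Qed.

Hypothesis N_ge0 : forall i j, 0 <= N i j.

Lemma abs_invmx_square0 : N *m N = 0 ->
  map_mx absz (invmx (1%:M + N)) = map_mx absz (1%:M + N).
Proof.
move=> NN0.
have -> : invmx (1%:M + N) = 1%:M - N.
  rewrite -[RHS](mulKmx unitmx_upper) mulmxBr mulmx1 mulmxDl mul1mx NN0 addr0.
  by rewrite addrK mulmx1.
apply/matrixP => i j; rewrite !mxE.
case: eqVneq => [->|_]; first by rewrite N_upper ?ltnn ?subr0 ?addr0.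
by rewrite !add0r abszN.
Qed.

Variable c : 'I_n -> bool.
Hypothesis N_colour : forall i j, N i j != 0 -> c i != c j.

(* Conjugating the inverse by the diagonal matrix of the signs of [c] turns
   1 + N into 1 - N, hence its inverse into 1 + N + N^2 + ... *)
Let C : 'M[int]_n :=
  \matrix_(i, j) ((-1) ^+ (c i (+) c j) * invmx (1%:M + N) i j).

Lemma signed_inverse_eq : C = 1%:M + N *m C.
Proof.
have Einv : invmx (1%:M + N) = 1%:M - N *m invmx (1%:M + N).
  have := mulmxV unitmx_upper; rewrite mulmxDl mul1mx => E.
  by rewrite -[X in X - _]E addrK.
apply/matrixP => i j; rewrite mxE Einv !mxE mulrBr.
rewrite mulr_sumr -sumrN; congr (_ + _).
  by case: eqVneq => [->|_]; rewrite ?addbb ?mul1r ?mulr0.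
apply: eq_bigr => k _.
have [->|/N_colour ck] := eqVneq (N i k) 0; first by rewrite !mul0r mulr0 oppr0.
have -> : c i = ~~ c k by case: (c i) (c k) ck => [] [].
by rewrite addNb signrN mulNr opprK mxE mulrCA.
Qed.

(** As [N] is strictly upper triangular, the equation above expresses row [i] of
    [C] by later rows; hence the induction on [n - i]. *)
Lemma signed_inverse_ge0 i j : 0 <= C i j.
Proof.
move: {2}(n - i)%N (leqnn (n - i)) => m.
elim: m i => [|m IHm] i le_m.
  by have := ltn_ord i; rewrite -subn_gt0 ltnNge le_m.
rewrite signed_inverse_eq !mxE addr_ge0 ?ler0n // sumr_ge0 // => k _.
have [lt_ik|le_ki] := ltnP i k; last by rewrite N_upper ?mul0r // -leqNgt.
rewrite mulr_ge0 ?N_ge0 // IHm // -ltnS (leq_trans _ le_m) //.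
by rewrite ltn_sub2l.
Qed.

(** The absolute value of the inverse is thus obtained by sign changes
    compatible with the matrix product. *)
Lemma abs_invmx_signed i j : `|invmx (1%:M + N) i j|%N%:Z = C i j.
Proof.
by rewrite -[RHS]ger0_norm ?signed_inverse_ge0 // mxE normrMsign abszE.
Qed.

(** Substituting the equation for [C] into itself gives
    [C = 1 + N + N^2 C] with all terms nonnegative, so the bound on the sum of
    the entries forces [N^2 C = 0]; and [C] is invertible. *)
Lemma square0_of_abs_sum :
  \sum_i \sum_j `|invmx (1%:M + N) i j|%N%:Z
    <= \sum_i \sum_j (1%:M + N) i j ->
  N *m N = 0.
Proof.
move=> le_sum.
have C_eq : C = 1%:M + N + N *m N *m C.
  rewrite {1}signed_inverse_eq {1}signed_inverse_eq mulmxDr mulmx1 addrA.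
  by rewrite mulmxA.
have NNC_ge0 i j : 0 <= (N *m N *m C) i j.
  rewrite -mulmxA !mxE sumr_ge0 // => k _; rewrite mulr_ge0 //.
  by rewrite mxE sumr_ge0 // => l _; rewrite mulr_ge0 ?signed_inverse_ge0.
have NNC0 : N *m N *m C = 0.
  have sum_le0 : \sum_i \sum_j (N *m N *m C) i j <= 0.
    rewrite -(lerD2l (\sum_i \sum_j (1%:M + N) i j)) addr0.
    apply: le_trans le_sum; rewrite -big_split /= le_eqVlt; apply/orP; left.
    apply/eqP/eq_bigr => i _; rewrite -big_split /=; apply: eq_bigr => j _.
    by rewrite abs_invmx_signed [in RHS]C_eq [in RHS]mxE.
  have row_ge0 i : 0 <= \sum_j (N *m N *m C) i j by rewrite sumr_ge0.
  have /eqP : \sum_i \sum_j (N *m N *m C) i j = 0.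
    by apply/eqP; rewrite eq_le sum_le0 sumr_ge0.
  rewrite psumr_eq0 // => /allP row0.
  apply/matrixP => i j; rewrite [RHS]mxE.
  have := row0 i (mem_index_enum _); rewrite /= psumr_eq0 // => /allP col0.
  by apply/eqP; have := col0 j (mem_index_enum _).
have CK : (1%:M - N) *m C = 1%:M.
  by rewrite mulmxBl mul1mx [X in X - _]signed_inverse_eq addrK.
by rewrite -[LHS]mulmx1 -(mulmx1C CK) mulmxA NNC0 mul0mx.
Qed.
End Unitriangular.


(** * Graphs with a labelled perfect matching *)

(** Applied to the pairs that join the two sides of the dual, this bounds the
    sum of the entries of |B^-1| without a description of the edges of the
    dual. *)
Lemma sum_ends_le (G : mgraph) (I : finType) (p : I -> {set vertex G}) :
  injective p -> \sum_i #|[set e | ends e == p i]| <= #|edge G|.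
Proof.
move=> p_inj; rewrite -(sum_card_fibres (@ends G)).
rewrite -(big_imset (fun A => #|[set e | ends e == A]|) (in2W p_inj)) /=.
by rewrite [leqRHS](bigID (mem [set p i | i in predT])) leq_addr.
Qed.

Section LabelledGraph.
Variables (G : mgraph) (M : {set edge G}) (n : nat) (L : labelling M n).
Let D := assoc_digraph L.
Local Notation l i := (L (lshift n i)).
Local Notation r i := (L (rshift n i)).

Let L_inj : injective L := bij_inj (lab_bij L).

Lemma lab_lr_neq i j : (l i == r j) = false.
Proof. by rewrite (inj_eq L_inj) eq_lrshift. Qed.

(* Membership of the first colour class, to be used with [set2_cross]. *)
Let left_side := [pred v | [exists k, v == l k]].
Let left_l k : left_side (l k).
Proof. by apply/existsP; exists k. Qed.
Let left_r k : ~~ left_side (r k).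
Proof. by apply/existsP => -[k']; rewrite eq_sym lab_lr_neq. Qed.

Lemma lab_pair_inj i j i' j' :
  [set l i; r j] = [set l i'; r j'] -> i = i' /\ j = j'.
Proof.
case/(set2_cross (left_l _) (left_r _) (left_l _) (left_r _)).
by move=> /L_inj/lshift_inj-> /L_inj/rshift_inj->.
Qed.

Lemma lab_bipartite : bipartite G.
Proof.
apply: (@bipartite_of_colour G left_side) => e.
by have [i [j Eij]] := lab_colour L e; exists (l i), (r j).
Qed.

Lemma matching_edge_ends e : e \in M -> exists i, ends e = [set l i; r i].
Proof.
move=> eM; have : ends e \in [set ends e | e in M] by rewrite imset_f.
by rewrite (lab_matching L) => /imsetP[i _ ->]; exists i.
Qed.

Lemma matching_edge_exists i : exists2 e, e \in M & ends e = [set l i; r i].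
Proof.
have : [set l i; r i] \in [set ends e | e in M].
  by rewrite (lab_matching L); apply/imsetP; exists i.
by case/imsetP=> e eM ->; exists e.
Qed.

Lemma arc_ends (a : darc D) : ends (val a).2 = [set l (src a); r (tgt a)].
Proof. by case/andP: (valP a) => _ /eqP. Qed.

Lemma arc_of_edge e i j : i != j -> ends e = [set l i; r j] ->
  exists a : darc D, [/\ (val a).2 = e, src a = i & tgt a = j].
Proof.
move=> neq_ij Ee.
have Pa : ((i, j, e).1.1 != (i, j, e).1.2) &&
     (ends (i, j, e).2 == [set l (i, j, e).1.1; r (i, j, e).1.2]).
  by rewrite neq_ij Ee eqxx.
by exists (exist (fun a : 'I_n * 'I_n * edge G => (a.1.1 != a.1.2) &&
     (ends a.2 == [set l a.1.1; r a.1.2])) _ Pa).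
Qed.

Lemma arc_edge_inj : injective (fun a : darc D => (val a).2).
Proof.
move=> a b /= E; have := arc_ends a; rewrite E (arc_ends b) => /lab_pair_inj[].
case: a b E => [[[i j] e] pa] [[[i' j'] e'] pb]; rewrite /src /tgt /=.
by move=> Ee Ei Ej; apply: val_inj; rewrite /= Ee Ei Ej.
Qed.

Lemma arc_lt (a : darc D) : src a < tgt a.
Proof.
have [/matching_edge_ends[i]|/(lab_upper L)[i [j [lt_ij]]]] :=
  boolP ((val a).2 \in M).
  rewrite arc_ends => /lab_pair_inj[Es Et].
  by have := src_neq_tgt a; rewrite Es Et eqxx.
by rewrite arc_ends => /lab_pair_inj[-> ->].
Qed.

Lemma diagonal_edge_matching e i : ends e = [set l i; r i] -> e \in M.
Proof.
move=> Ee; apply/negPn/negP => /(lab_upper L)[j [k [lt_jk]]].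
by rewrite Ee => /lab_pair_inj[Ej Ek]; rewrite -Ej -Ek ltnn in lt_jk.
Qed.

Definition arc_mx : 'M[int]_n :=
  \matrix_(i, j) Posz #|[set a : darc D | (src a == i) && (tgt a == j)]|.

Lemma arc_mx_ge0 i j : (0 <= arc_mx i j)%R.
Proof. by rewrite mxE. Qed.

Lemma arc_mx_neq0 i j :
  arc_mx i j != 0%R -> exists2 a : darc D, src a = i & tgt a = j.
Proof.
rewrite mxE eqz_nat cards_eq0 => /set0Pn[a].
by rewrite inE => /andP[/eqP <- /eqP <-]; exists a.
Qed.

Lemma arc_mx_pos (a : darc D) : (0 < arc_mx (src a) (tgt a))%R.
Proof.
rewrite mxE ltz_nat card_gt0; apply/set0Pn.
by exists a; rewrite inE !eqxx.
Qed.

Lemma arc_mx_upper (i j : 'I_n) : ~~ (i < j) -> arc_mx i j = 0%R.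
Proof.
move=> nlt_ij; apply/eqP/negPn/negP => /arc_mx_neq0[a Ei Ej].
by rewrite -Ei -Ej arc_lt in nlt_ij.
Qed.

Lemma assoc_mxE : assoc_mx L = (1%:M + arc_mx)%R.
Proof.
apply/matrixP => i j; rewrite [RHS]mxE [(1%:M)%R i j]mxE mxE.
case: eqVneq => [->|_]; last by rewrite [arc_mx i j]mxE add0r.
by rewrite arc_mx_upper ?ltnn.
Qed.

(** By [card_edge_lab] below, this is the number of edges of [G] if the matching
    is perfect. *)
Lemma sum_assoc_mx :
  (\sum_i \sum_j (1%:M + arc_mx) i j = (n + #|darc D|)%N%:Z :> int)%R.
Proof.
under eq_bigr do under eq_bigr do rewrite mxE.
under eq_bigr do rewrite big_split /=.
rewrite big_split PoszD /=; congr (_ + _)%R.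
  under eq_bigr => i _.
    rewrite (bigD1 i) //= mxE eqxx big1 ?addr0; last first.
      by move=> j /negPf ji; rewrite mxE eq_sym ji.
    over.
  by rewrite sumr_const card_ord natz.
rewrite pair_big /= -(sum_card_fibres (fun a : darc D => (src a, tgt a))).
rewrite -[RHS]natz natr_sum; apply: eq_bigr => -[i j] _ /=.
by rewrite mxE natz.
Qed.

Hypothesis M_perfect : perfect_matching M.

Lemma matching_edge_uniq e e' v :
  e \in M -> e' \in M -> v \in ends e -> v \in ends e' -> e = e'.
Proof.
move=> eM e'M ve ve'; have /eqP/cards1P[e0 E] := M_perfect v.
have : e \in [set e in M | v \in ends e] by rewrite inE eM.
have : e' \in [set e in M | v \in ends e] by rewrite inE e'M.
by rewrite E !inE => /eqP-> /eqP->.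
Qed.

(** Each edge of [G] is an arc of [D] or one of the [n] matching edges. This
    gives the number of edges of [G] and the edges of the corona. *)
Lemma edge_decomposition :
  exists g : darc D + 'I_n -> edge G,
  [/\ bijective g, forall a, g (inl a) = (val a).2
    & forall i, ends (g (inr i)) = [set l i; r i]].
Proof.
have /fin_all_exists[m mE] : forall i, exists e,
    e \in M /\ ends e = [set l i; r i].
  by move=> i; have [e] := matching_edge_exists i; exists e.
pose g (x : darc D + 'I_n) :=
  match x with inl a => (val a).2 | inr i => m i end.
exists g; split=> //; last by move=> i; case: (mE i).
have neq_ai (a : darc D) i : g (inl a) <> g (inr i).
  move=> /= E; have := arc_ends a; rewrite E (mE i).2 => /lab_pair_inj[Es Et].
  by have := src_neq_tgt a; rewrite -Es -Et eqxx.
apply: surj_inj_bij.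
  move=> [a|i] [b|j] E.
  - by congr inl; apply: arc_edge_inj E.
  - by case: (neq_ai _ _ E).
  - by case: (neq_ai _ _ (esym E)).
  - have := (mE i).2; rewrite -[m i]/(g (inr i)) E (mE j).2.
    by case/lab_pair_inj=> ->.
move=> e; have [i [j Eij]] := lab_colour L e.
have [E|neq_ij] := eqVneq i j; last first.
  by have [a [Ea _ _]] := arc_of_edge neq_ij Eij; exists (inl a).
subst j; exists (inr i); apply: (@matching_edge_uniq _ _ (l i)).
- by case: (mE i).
- exact: diagonal_edge_matching Eij.
- by rewrite /= (mE i).2 set21.
- by rewrite Eij set21.
Qed.

Lemma card_edge_lab : #|edge G| = n + #|darc D|.
Proof.
have [g [g_bij _ _]] := edge_decomposition.
by rewrite -(bij_eq_card g_bij) card_sum card_ord addnC.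
Qed.

(** A perfect matching that admits a labelling has no edge parallel to one of
    its edges, so the formula also holds on the diagonal. *)
Lemma mult_lab i j : mult (l i) (r j) = `|assoc_mx L i j|.
Proof.
have [g [_ _ gr]] := edge_decomposition.
rewrite mxE absz_nat /mult; case: eqVneq => [<-|neq_ij].
  apply/eqP/cards1P; exists (g (inr i)); apply/setP => e; rewrite !inE.
  apply/eqP/eqP => [Ee|->] //; apply: (@matching_edge_uniq _ _ (l i)).
  - exact: diagonal_edge_matching Ee.
  - exact: diagonal_edge_matching (gr i).
  - by rewrite Ee set21.
  - by rewrite gr set21.
rewrite -(card_imset _ arc_edge_inj); apply: eq_card => e; rewrite inE.
apply/eqP/imsetP => [/(arc_of_edge neq_ij)[a [<- Es Et]]|[a + ->]].
  by exists a; rewrite // inE Es Et !eqxx.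
by rewrite inE => /andP[/eqP<- /eqP<-]; rewrite arc_ends.
Qed.

Definition no_consecutive_arcs := forall a b : darc D, tgt a != src b.

(** The entries of [N^2] are sums of nonnegative terms and count the pairs of
    consecutive arcs. *)
Lemma arc_mx_square0P : (arc_mx *m arc_mx = 0)%R <-> no_consecutive_arcs.
Proof.
split=> [sq0 a b|no2].
  apply/eqP => E; have : ((arc_mx *m arc_mx) (src a) (tgt b) = 0)%R.
    by rewrite sq0 mxE.
  apply/eqP; rewrite gt_eqF // mxE (bigD1 (tgt a)) // ltr_wpDr //.
    by rewrite sumr_ge0 // => k _; rewrite mulr_ge0 ?arc_mx_ge0.
  by rewrite mulr_gt0 ?arc_mx_pos // E arc_mx_pos.
apply/matrixP => i j; rewrite !mxE big1 // => k _; apply/eqP/negPn/negP.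
rewrite mulf_eq0 negb_or => /andP[/arc_mx_neq0[a _ Ea] /arc_mx_neq0[b Eb _]].
by have := no2 a b; rewrite Ea Eb eqxx.
Qed.

Lemma underlying_bipartite_of_no_consecutive :
  no_consecutive_arcs -> bipartite (underlying D).
Proof.
move=> no2; pose c i := [exists a : darc D, src a == i].
have outs (a : darc D) : c (src a) by apply/existsP; exists a.
have outt (a : darc D) : ~~ c (tgt a).
  by apply/existsP => -[b]; rewrite eq_sym (negPf (no2 a b)).
by apply: (@bipartite_of_colour (underlying D) c) => a; exists (src a), (tgt a).
Qed.

(** The inequality between sums of entries compares the number of edges of the
    dual with that of [G]. *)
Lemma no_consecutive_of_self_dual :
  self_dual L -> bipartite (underlying D) -> no_consecutive_arcs.
Proof.
move=> [f [g [_ g_bij _]]] [c cP]; apply/arc_mx_square0P.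
apply: (square0_of_abs_sum arc_mx_upper arc_mx_ge0 (c := c)).
  by move=> i j /arc_mx_neq0[a <- <-]; apply: (cP a).
rewrite sum_assoc_mx -card_edge_lab (bij_eq_card g_bij).
pose p (x : 'I_n * 'I_n) : {set vertex (dual_graph L)} :=
  [set rshift n x.1; lshift n x.2].
have p_inj : injective p.
  pose P := [pred v : 'I_(n + n) | [exists k, v == rshift n k]].
  have Pr k : P (rshift n k) by apply/existsP; exists k.
  have Pl k : ~~ P (lshift n k) by apply/existsP => -[k']; rewrite eq_lrshift.
  move=> [i j] [i' j'] /(set2_cross (Pr _) (Pl _) (Pr _) (Pl _))[].
  by move=> /rshift_inj/= -> /lshift_inj/= ->.
apply: le_trans (_ : _ <= (\sum_x #|[set e | ends e == p x]|)%N%:Z)%R _;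
  last first.
  by rewrite lez_nat sum_ends_le.
rewrite -[leRHS]natz natr_sum pair_big /= le_eqVlt; apply/orP; left.
apply/eqP/eq_bigr => -[i j] _; rewrite natz; congr Posz.
have := mult_dual_graph (L := L) (rshift n i) (lshift n j).
by rewrite /mult /p /= => ->; rewrite /dual_mx block_mxEdl mxE assoc_mxE.
Qed.

(** As |B^-1| = B, the dual joins the labels [n + i] and [j] as often as [G]
    joins [i] and [n + j]: the isomorphism exchanges the two halves of the
    labels. *)
Lemma self_dual_of_no_consecutive : no_consecutive_arcs -> self_dual L.
Proof.
move/arc_mx_square0P=> sq0.
have mult_dual i j : mult (rshift n i : vertex (dual_graph L)) (lshift n j)
    = mult (l i) (r j).
  rewrite mult_dual_graph /dual_mx block_mxEdl assoc_mxE.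
  rewrite abs_invmx_square0 //; first by rewrite mxE mult_lab assoc_mxE.
  - exact: arc_mx_upper.
have [L' LK L'K] := lab_bij L.
pose swap (k : 'I_(n + n)) : 'I_(n + n) :=
  match split k with inl i => rshift n i | inr i => lshift n i end.
have swap_l i : swap (lshift n i) = rshift n i.
  by rewrite /swap -[lshift n i]/(unsplit (inl i)) unsplitK.
have swap_r i : swap (rshift n i) = lshift n i.
  by rewrite /swap -[rshift n i]/(unsplit (inr i)) unsplitK.
have swapK : involutive swap.
  by move=> k; case: (split_ordP k) => i ->; rewrite ?(swap_l, swap_r).
have mult_ll i j : mult (l i) (l j) = 0.
  apply/eqP; rewrite cards_eq0; apply/eqP/setP => e; rewrite !inE.
  apply/negP => /eqP Ee; have [i' [j' Ee']] := lab_colour L e.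
  have : r j' \in [set l i; l j] by rewrite -Ee Ee' set22.
  by rewrite !inE ![r _ == _]eq_sym !lab_lr_neq.
have mult_rr i j : mult (r i) (r j) = 0.
  apply/eqP; rewrite cards_eq0; apply/eqP/setP => e; rewrite !inE.
  apply/negP => /eqP Ee; have [i' [j' Ee']] := lab_colour L e.
  have : l i' \in [set r i; r j] by rewrite -Ee Ee' set21.
  by rewrite !inE !lab_lr_neq.
apply: (@isomorphic_of_mult G (dual_graph L) (swap \o L')).
  by apply: (bij_comp (inv_bij swapK)); exists L.
move=> u v; rewrite -[u]L'K -[v]L'K /= !LK.
case: (split_ordP (L' u)) => i ->; case: (split_ordP (L' v)) => j ->;
  rewrite ?(swap_l, swap_r).
- by rewrite mult_ll mult_dual_graph /dual_mx block_mxEdr mxE.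
- by rewrite mult_dual.
- by rewrite mult_sym -mult_dual mult_sym.
- by rewrite mult_rr mult_dual_graph /dual_mx block_mxEul mxE.
Qed.

(** Vertex [i] of [D] becomes the end of the [i]-th matching edge that may have
    further neighbours: the first one if [i] has an outgoing arc, and otherwise
    the second one. *)
Lemma corona_of_no_consecutive :
  no_consecutive_arcs -> isomorphic G (corona (underlying D)).
Proof.
move=> no2; apply: isomorphic_sym.
pose out i := [exists a : darc D, src a == i].
have outs (a : darc D) : out (src a) by apply/existsP; exists a.
have outt (a : darc D) : out (tgt a) = false.
  by apply/existsP => -[b]; rewrite eq_sym (negPf (no2 a b)).
pose f (x : vertex (corona (underlying D))) : vertex G :=
  match x with
  | inl i => if out i then l i else r i
  | inr i => if out i then r i else l i
  end.
have [g [g_bij gl gr]] := edge_decomposition.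
exists f, g; split=> //.
  apply: inj_card_bij; last first.
    by rewrite -(bij_eq_card (lab_bij L)) card_sum !card_ord.
  by move=> [i|i] [j|j]; rewrite /f; case: ifP => oi; case: ifP => oj /L_inj E;
    first [ move/lshift_inj: E => E | move/rshift_inj: E => E
          | by move/eqP: E; rewrite ?eq_lrshift ?eq_rlshift ];
    rewrite E ?oj // in oi *.
move=> [a|i].
  rewrite gl arc_ends /= -imset_comp imsetU !imset_set1 /= /f /=.
  by rewrite outs outt.
rewrite gr /= imsetU !imset_set1 /f.
by case: ifP => // _; rewrite setUC.
Qed.
End LabelledGraph.

(** * The labelling of the corona of a bipartite graph *)

Section CoronaLabelling.
Variables (H : mgraph) (c : vertex H -> bool).
Hypothesis cP : forall (e : edge H) u v, ends e = [set u; v] -> c u != c v.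

Lemma coloured_enumeration : exists s : seq (vertex H),
  [/\ uniq s, forall v, v \in s
    & forall i j : 'I_(size s),
        ~~ c (tnth (in_tuple s) i) -> c (tnth (in_tuple s) j) -> i < j].
Proof.
(* Sorting by colour puts the vertices of colour [false] first. *)
pose le u v := c u ==> c v.
have le_total : total le by move=> u v; rewrite /le; case: (c u) (c v) => [] [].
have le_trans : transitive le.
  by move=> u v w; rewrite /le; case: (c u) (c v) (c w) => [] [] [].
have le_refl : reflexive le by move=> u; rewrite /le implybb.
exists (sort le (enum (vertex H))); split.
- by rewrite sort_uniq enum_uniq.
- by move=> v; rewrite mem_sort mem_enum.
move=> i j ci cj; rewrite ltnNge; apply/negP => le_ji.
have v0 := tnth (in_tuple (sort le (enum (vertex H)))) i.
move: ci cj; rewrite !(tnth_nth v0) /= => ci cj.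
have := sorted_leq_nth le_trans le_refl v0 (sort_sorted le_total _)
  j i (ltn_ord j) (ltn_ord i) le_ji.
by rewrite /le cj (negPf ci).
Qed.

Variables (G : mgraph) (f : vertex (corona H) -> vertex G).
Variable g : edge (corona H) -> edge G.
Hypotheses (f_bij : bijective f) (g_bij : bijective g).
Hypothesis fg : forall e, ends (g e) = f @: ends e.

Let f_inj : injective f := bij_inj f_bij.
Let g_inj : injective g := bij_inj g_bij.

Let M := [set g (inr v) | v in vertex H].

Let ends_inr v : ends (g (inr v)) = [set f (inl v); f (inr v)].
Proof. by rewrite fg /= imsetU !imset_set1. Qed.

Let ends_inl e u v :
  ends e = [set u; v] -> ends (g (inl e)) = [set f (inl u); f (inl v)].
Proof. by move=> Ee; rewrite fg /= Ee !imsetU !imset_set1. Qed.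

Let edgeP e : (exists v, e = g (inr v)) \/
  exists h u v, [/\ e = g (inl h), ends h = [set u; v], ~~ c u & c v].
Proof.
have [g' _ g'K] := g_bij; rewrite -[e]g'K; case: (g' e) => [h|v]; last first.
  by left; exists v.
right; have /eqP/cards2P[u [v [_ Eh]]] := card_ends h.
have := cP Eh; case Eu: (c u); case Ev: (c v) => // _.
  by exists h, v, u; rewrite Eu Ev setUC.
by exists h, u, v; rewrite Eu Ev.
Qed.

(** A perfect matching contains the only edge at each pendant vertex; these
    edges already cover all vertices, which leaves no room for another one. *)
Lemma corona_perfect_matching : unique (@perfect_matching G) M.
Proof.
split=> [w|M' M'_perfect].
  have [f' _ f'K] := f_bij; rewrite -[w]f'K; apply/eqP/cards1P.
  pose v := match f' w with inl v => v | inr v => v end.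
  exists (g (inr v)); apply/setP => e; rewrite !inE.
  apply/andP/eqP => [[/imsetP[u _ ->]]|->].
    rewrite ends_inr !inE !(inj_eq f_inj) /v.
    by case: (f' w) => x /orP[]/eqP[] // ->.
  rewrite imset_f // ends_inr !inE !(inj_eq f_inj) /v.
  by case: (f' w) => x; rewrite eqxx ?orbT.
have edge_at (w : vertex G) : exists2 e, e \in M' & w \in ends e.
  have /eqP/cards1P[e E] := M'_perfect w.
  by have := set11 e; rewrite -E inE => /andP[]; exists e.
have sub_MM' : M \subset M'.
  apply/subsetP => _ /imsetP[v _ ->].
  have [e eM'] := edge_at (f (inr v)).
  case: (edgeP e) eM' => [[u ->]|[h [x [y [-> Eh _ _]]]]] eM'.
    by rewrite ends_inr !inE !(inj_eq f_inj) => /orP[]/eqP[] // ->.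
  by rewrite (ends_inl Eh) !inE !(inj_eq f_inj).
apply/eqP; rewrite eqEsubset sub_MM'; apply/subsetP => e eM'.
case: (edgeP e) => [[v ->]|[h [x [y [Ee Eh _ _]]]]]; first by rewrite imset_f.
have xM' : g (inr x) \in M' by rewrite (subsetP sub_MM') ?imset_f.
have /eqP/cards1P[e0 E] := M'_perfect (f (inl x)).
have : e \in [set e in M' | f (inl x) \in ends e].
  by rewrite inE eM' Ee (ends_inl Eh) set21.
have : g (inr x) \in [set e in M' | f (inl x) \in ends e].
  by rewrite inE xM' ends_inr set21.
by rewrite E !inE Ee => /eqP<- /eqP/g_inj.
Qed.

(** A vertex of [H] gets a label in the first half if its colour is [false], and
    in the second half otherwise; its pendant neighbour gets the opposite label.
    Arcs then lead from colour [false] to colour [true], and so cannot be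
    chained. *)
Lemma corona_labelling : exists n (L : labelling M n), no_consecutive_arcs L.
Proof.
have [s [s_uniq s_all s_col]] := coloured_enumeration.
pose n := size s; pose vtx : 'I_n -> vertex H := tnth (in_tuple s).
have vtx_inj : injective vtx by apply/tuple_uniqP.
have vtx_surj v : exists i, vtx i = v.
  by have /tnthP[i ->] : v \in in_tuple s by []; exists i.
pose lft i := f (if c (vtx i) then inr (vtx i) else inl (vtx i)).
pose rgt i := f (if c (vtx i) then inl (vtx i) else inr (vtx i)).
pose L (k : 'I_(n + n)) :=
  match split k with inl i => lft i | inr i => rgt i end.
have L_l i : L (lshift n i) = lft i.
  by rewrite /L -[lshift n i]/(unsplit (inl i)) unsplitK.
have L_r i : L (rshift n i) = rgt i.
  by rewrite /L -[rshift n i]/(unsplit (inr i)) unsplitK.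
have pair i : [set lft i; rgt i] = [set f (inl (vtx i)); f (inr (vtx i))].
  by rewrite /lft /rgt; case: ifP => // _; rewrite setUC.
have lft_out i : ~~ c (vtx i) -> lft i = f (inl (vtx i)).
  by rewrite /lft => /negPf->.
have rgt_in i : c (vtx i) -> rgt i = f (inl (vtx i)) by rewrite /rgt => ->.
have L_bij : bijective L.
  apply: surj_inj_bij.
    move=> k k'; case: (split_ordP k) => i ->; case: (split_ordP k') => j ->;
      rewrite ?(L_l, L_r) /lft /rgt => /f_inj.
    - by case: ifP => ci; case: ifP => cj // [/vtx_inj->].
    - by case: ifP => ci; case: ifP => cj // [Eij]; rewrite Eij cj in ci.
    - by case: ifP => ci; case: ifP => cj // [Eij]; rewrite Eij cj in ci.
    - by case: ifP => ci; case: ifP => cj // [/vtx_inj->].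
  move=> w; have [f' _ f'K] := f_bij; rewrite -[w]f'K.
  case: (f' w) => v; have [i <-] := vtx_surj v.
    case ci: (c (vtx i)); [exists (rshift n i) | exists (lshift n i)];
      by rewrite ?(L_l, L_r) /lft /rgt ci.
  case ci: (c (vtx i)); [exists (lshift n i) | exists (rshift n i)];
    by rewrite ?(L_l, L_r) /lft /rgt ci.
have matchingE : [set ends e | e in M] =
    [set [set L (lshift n i); L (rshift n i)] | i : 'I_n].
  apply/setP => A; apply/imsetP/imsetP => [[_ /imsetP[v _ ->] ->]|[i _ ->]].
    have [i <-] := vtx_surj v; exists i => //.
    by rewrite L_l L_r pair ends_inr.
  by exists (g (inr (vtx i))); rewrite ?imset_f // L_l L_r pair ends_inr.
have hub_ends h u v : ends h = [set u; v] -> ~~ c u -> c v -> exists i j : 'I_n,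
    i < j /\ ends (g (inl h)) = [set L (lshift n i); L (rshift n j)].
  have [i <-] := vtx_surj u; have [j <-] := vtx_surj v => Eh ci cj.
  exists i, j; split; first exact: s_col.
  by rewrite L_l L_r lft_out ?rgt_in // (ends_inl Eh).
have colour e : exists i j : 'I_n,
    ends e = [set L (lshift n i); L (rshift n j)].
  case: (edgeP e) => [[v ->]|[h [u [v [-> Eh cu cv]]]]].
    have [i <-] := vtx_surj v; exists i, i.
    by rewrite L_l L_r pair ends_inr.
  by have [i [j [_ E]]] := hub_ends _ _ _ Eh cu cv; exists i, j.
have upper e : e \notin M -> exists i j : 'I_n,
    i < j /\ ends e = [set L (lshift n i); L (rshift n j)].
  case: (edgeP e) => [[v ->]|[h [u [v [-> Eh cu cv]]]]] eM.
    by rewrite imset_f in eM.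
  exact: hub_ends Eh cu cv.
pose LL := Labelling L_bij matchingE colour upper.
have arc_colour (a : darc (assoc_digraph LL)) :
    ~~ c (vtx (src a)) /\ c (vtx (tgt a)).
  have Ea := arc_ends a.
  case: (edgeP (val a).2) => [[v Ev]|[h [u [v [Eh Euv cu cv]]]]].
    have [i Ei] := vtx_surj v.
    have := src_neq_tgt a.
    have : [set LL (lshift n i); LL (rshift n i)]
         = [set LL (lshift n (src a)); LL (rshift n (tgt a))].
      by rewrite -Ea Ev ends_inr -Ei -pair -L_l -L_r.
    by case/lab_pair_inj=> <- <-; rewrite eqxx.
  have [i Ei] := vtx_surj u; have [j Ej] := vtx_surj v.
  have : [set LL (lshift n i); LL (rshift n j)]
       = [set LL (lshift n (src a)); LL (rshift n (tgt a))].
    by rewrite -Ea Eh (ends_inl Euv) /= L_l L_r lft_out ?Ei // rgt_in ?Ej.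
  by case/lab_pair_inj=> <- <-; rewrite Ei Ej.
exists n, LL; rewrite /no_consecutive_arcs => a b; apply/negP => /eqP E.
have [_ ct] := arc_colour a; have [cs _] := arc_colour b.
by rewrite E (negPf cs) in ct.
Qed.
End CoronaLabelling.

Theorem corollary3p12 (G : mgraph) :
  (exists H : mgraph, bipartite H /\ isomorphic G (corona H)) <->
  (bipartite G /\
   exists M : {set edge G}, unique (@perfect_matching G) M /\
   exists (n : nat) (L : labelling M n),
     self_dual L /\ bipartite (underlying (assoc_digraph L))).
Proof.
split=> [[H [[c cP] /isomorphic_sym[f [g [f_bij g_bij fg]]]]]|].
  have M_unique := corona_perfect_matching cP f_bij g_bij fg.
  have [n [L no2]] := corona_labelling cP f_bij g_bij fg.
  split; first exact: lab_bipartite L.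
  exists [set g (inr v) | v in vertex H]; split=> //; exists n, L; split.
    by apply: self_dual_of_no_consecutive => //; case: M_unique.
  exact: underlying_bipartite_of_no_consecutive.
case=> _ [M [[M_perfect _] [n [L [L_dual D_bip]]]]].
exists (underlying (assoc_digraph L)); split=> //.
apply: corona_of_no_consecutive => //; exact: no_consecutive_of_self_dual.
Qed.
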